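(* Let $G=\{x\in\mathbb{R} : x\in\mathbb{Q}\ \text{or}\ a_n(x)\to\infty \text{ as } n\to\infty\}$. For any $\alpha\in[0,1]$, the Shulga decomposition $\alpha=\beta+\gamma$ satisfies $\beta,\gamma\in G$. Moreover, if $\alpha\in\mathbb{Q}$ then $\beta,\gamma\in\mathbb{Q}$.
   Context: Continued fractions: $[a_0;a_1,a_2,\ldots]=a_0+\cfrac{1}{a_1+\cfrac{1}{a_2+\cdots}}$ with $a_0\in\mathbb{Z}$ and positive integers $a_i$ ($i\ge1$). For rational numbers one uses the finite expansion whose last partial quotient is greater than $1$, except that for the number $1$ one uses $1=[0;1]$, i.e. $a_1(1)=1$. $a_n(x)$ denotes the $n$th partial quotient of $x$ (undefined if $n$ exceeds the length of the expansion). An empty list of partial quotients gives $[0;\,]=0$. Shulga's algorithm for $\alpha\in[0,1]$: for $n=0,1,2,\ldots$, suppose $b_k,c_k$ are defined for $1\le k\le n$. If $\alpha=[0;b_1,\ldots,b_n]+[0;c_1,\ldots,c_n]$, put $\beta=[0;b_1,\ldots,b_n]$, $\gamma=[0;c_1,\ldots,c_n]$ and stop. Otherwise define $$b_{n+1}=a_{n+1}(\alpha-[0;c_1,\ldots,c_n])+1,\qquad c_{n+1}=a_{n+1}(\alpha-[0;b_1,\ldots,b_n,b_{n+1}]).$$ If the algorithm never stops, put $\beta=[0;b_1,b_2,\ldots]$, $\gamma=[0;c_1,c_2,\ldots]$. It is known (Shulga) that these quantities are always well defined and that $\alpha=\beta+\gamma$; this is called the Shulga decomposition of $\alpha$. 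*)

(* Defs.v *)
(* The real numbers are an arbitrary R : realType. *)
From HB Require Import structures.
From mathcomp Require Import all_boot all_order all_algebra.
From mathcomp Require Import all_classical all_reals all_analysis.

Set Implicit Arguments.
Unset Strict Implicit.
Unset Printing Implicit Defensive.

Import Order.TTheory GRing.Theory Num.Theory.
Import numFieldNormedType.Exports.

Local Open Scope classical_set_scope.
Local Open Scope ring_scope.

(* [0; s_1, ..., s_k] for s = [:: s_1; ...; s_k]; the empty list gives 0. *)
Definition cfrac (R : realType) (s : seq nat) : R :=
  foldr (fun a t => (a%:R + t)^-1) 0 s.

(* Sequences of partial quotients a : nat -> nat are indexed from 1: the value
   a 0 is never used, the integer part a_0 being always given separately. *)

(* [0; a_1, ..., a_n] *)
Definition convergent (R : realType) (a : nat -> nat) (n : nat) : R :=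
  cfrac R [seq a i | i <- iota 1 n].

(* x = [a0; s_1, ..., s_k], normalised to have its last partial quotient
   greater than 1, except that 1 = [0; 1]. For k = 0 there is no condition on
   the last partial quotient: an integer a0 other than 1 is written [a0]. *)
Definition finite_expansion (R : realType) (x : R) (a0 : int) (s : seq nat) :
    Prop :=
  [/\ all (fun a => 0 < a)%N s,
      x = a0%:~R + cfrac R s
    & if x == 1 then a0 = 0 /\ s = [:: 1%N] else (1 < last 2 s)%N].

(* x = [a0; a_1, a_2, ...] *)
Definition infinite_expansion (R : realType) (x : R) (a0 : int)
    (a : nat -> nat) : Prop :=
  (forall i, (0 < i)%N -> (0 < a i)%N) /\
  (a0%:~R + convergent R a n) @[n --> \oo] --> x.

(* For n >= 1: the n-th partial quotient a_n(x) is defined and equal to m. *)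
Definition partial_quotient (R : realType) (x : R) (n m : nat) : Prop :=
  (0 < n)%N /\
  ((exists a0 s,
      [/\ finite_expansion x a0 s, (n <= size s)%N & m = nth 0%N s n.-1]) \/
   (exists a0 a, infinite_expansion x a0 a /\ m = a n)).

Definition G (R : realType) : set R :=
  [set x | rational x \/
    exists a : nat -> nat,
      (forall n, (0 < n)%N -> partial_quotient x n (a n)) /\
      a n @[n --> \oo] --> \oo].

Definition shulga_stop (R : realType) (alpha : R) (b c : nat -> nat)
    (n : nat) : Prop :=
  alpha = convergent R b n + convergent R c n.

(* b_{n+1} = a_{n+1}(alpha - [0; c_1, ..., c_n]) + 1 and
   c_{n+1} = a_{n+1}(alpha - [0; b_1, ..., b_{n+1}]), both being defined. *)
Definition shulga_step (R : realType) (alpha : R) (b c : nat -> nat)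
    (n : nat) : Prop :=
  (exists2 m, partial_quotient (alpha - convergent R c n) n.+1 m
            & b n.+1 = m.+1) /\
  partial_quotient (alpha - convergent R b n.+1) n.+1 (c n.+1).

(* beta and gamma are the outputs of the algorithm run on alpha. In the
   terminating case the values of b and c beyond n are irrelevant. *)
Definition shulga_decomposition (R : realType) (alpha beta gamma : R) : Prop :=
  exists b c : nat -> nat,
    (exists n,
       [/\ forall k, (k < n)%N ->
             ~ shulga_stop alpha b c k /\ shulga_step alpha b c k,
           shulga_stop alpha b c n,
           beta = convergent R b n
         & gamma = convergent R c n]) \/
    [/\ forall k, ~ shulga_stop alpha b c k /\ shulga_step alpha b c k,
        convergent R b n @[n --> \oo] --> beta
      & convergent R c n @[n --> \oo] --> gamma].

(* Main.v *)
Require Import Defs.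
From mathcomp Require Import all_boot all_order all_algebra.
From mathcomp Require Import all_classical all_reals all_analysis.
From mathcomp Require Import zify ring lra.

(** Write r_n and q_n for the denominators of the convergents beta_n of [b] and
    gamma_n of [c]. As long as the algorithm runs,

      alpha - beta_n = [0; c_1, ..., c_n + t]   with 0 < t < 1

    (t = 1 is possible for n = 0 only), so alpha - beta_n - gamma_n is, up to
    the sign (-1)^n, equal to 1/W with W = q_n (q_n/t + q_(n-1)). Writing 1/W
    as a perturbation of beta_n instead of gamma_n gives the complete quotient
    y of alpha - gamma_n after b_1, ..., b_n, through
    W = r_n (y r_n + r_(n-1)). The algorithm rounds y up to
    b_(n+1) = y + s with 0 < s <= 1, overshoots by
    1/V = 1/W - 1/(r_n r_(n+1)), and reads c_(n+1) off the complete quotient z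
    of V = q_n (z q_n + q_(n-1)). The round makes sense because y > 1 (y = 1 if
    alpha = 1), which comes from r_n <= q_n and r_(n-1) <= q_(n-1), and because
    V > W, which gives z > 1: this is [round_step].

    Comparing W and V shows that the ratio h_n = (q_n + q_(n-1)) / r_n strictly
    increases ([round_inequalities]); the integer [drift] is the numerator of
    its increment. Two consecutive drifts satisfy the identity ([driftD])

      drift_(n+1) + drift_n =
        r_(n+1) ((c_(n+2) - b_(n+2)) q_(n+1) + (c_(n+1) - b_(n+2)) q_n),

    and positivity of the drifts forces b_i <= c_i for all i, hence r_n <= q_n, which keeps the algorithm going ([drift_dominates]).

    The heart of the matter is that h_n tends to infinity when the algorithm
    never stops ([ratio_unbounded]). If h_n were bounded, the partial quotients
    would be bounded, and the increments of h_n would tend to zero; then the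
    bracket above would be positive but smaller than q_n, which for integers
    is possible only if c_(n+2) > b_(n+2) > c_(n+1). So [c] would increase
    strictly from some point on, contradicting its boundedness.

    Everything follows. The inequality q_n (q_n + q_(n-1)) <= r_n r_(n+1) gives
    b_(n+1) + 1 >= h_n, so b_n and c_n >= b_n tend to infinity. The error
    |alpha - beta_n - gamma_n| is at most 1 / (q_n (q_n + q_(n-1))), so
    alpha = beta + gamma; and if Q alpha were an integer, this nonzero error
    would be at least 1 / (Q r_n q_n), so h_n <= Q for all n. Hence the
    algorithm stops on rational numbers, and then beta and gamma are
    rational. *)

Import Order.TTheory GRing.Theory Num.Theory.
Import numFieldNormedType.Exports.
Local Open Scope classical_set_scope.
Local Open Scope ring_scope.

(** * Continued fractions with a tail *)

(** This is [0; s_1, ..., s_k + t]: the remainder [t] of an expansion that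
    starts with [s] is kept as an unknown. *)
Definition cfrac_tail {R : realType} (s : seq nat) (t : R) : R :=
  foldr (fun a x => (a%:R + x)^-1) t s.

Definition digits (a : nat -> nat) (n : nat) : seq nat :=
  [seq a i | i <- iota 1 n].

Definition positive_upto (a : nat -> nat) (n : nat) : Prop :=
  forall i, (0 < i <= n)%N -> (0 < a i)%N.

Lemma size_digits a n : size (digits a n) = n.
Proof. by rewrite size_map size_iota. Qed.

Lemma digitsS a n : digits a n.+1 = rcons (digits a n) (a n.+1).
Proof. by rewrite /digits -[in LHS](addn1 n) iotaD map_cat cats1 add1n. Qed.

Lemma digits_cons a n : digits a n.+1 = a 1%N :: digits (a \o succn) n.
Proof.
rewrite /digits /=; congr cons.
by rewrite (iotaDl 1 1) -map_comp.
Qed.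

Lemma positive_digits {a n} :
  positive_upto a n -> all (fun x => 0 < x)%N (digits a n).
Proof.
move=> apos; apply/allP => _ /mapP[i + ->].
rewrite mem_iota => ?; apply: apos; lia.
Qed.

Lemma positive_uptoW {a n m} : (m <= n)%N -> positive_upto a n ->
  positive_upto a m.
Proof. by move=> mn apos i /andP[i0 im]; apply: apos; lia. Qed.

Lemma positive_uptoS a n : positive_upto a n -> (0 < a n.+1)%N ->
  positive_upto a n.+1.
Proof.
move=> apos an i /andP[i0]; rewrite leq_eqVlt => /orP[/eqP->//|].
by rewrite ltnS => il; apply: apos; rewrite i0.
Qed.

Lemma positive_all a n : (forall i, (0 < i)%N -> (0 < a i)%N) ->
  positive_upto a n.
Proof. by move=> apos i /andP[/apos]. Qed.

Lemma cfrac_cons (R : realType) a s : cfrac R (a :: s) = (a%:R + cfrac R s)^-1.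
Proof. by []. Qed.

Lemma cfrac_tail_cons (R : realType) a s (t : R) :
  cfrac_tail (a :: s) t = (a%:R + cfrac_tail s t)^-1.
Proof. by []. Qed.

Lemma cfrac_tail_rcons (R : realType) s a (t : R) :
  cfrac_tail (rcons s a) t = cfrac_tail s (a%:R + t)^-1.
Proof. by rewrite /cfrac_tail foldr_rcons. Qed.

Lemma cfrac_tail_itv (R : realType) s (t : R) :
  all (fun x => 0 < x)%N s -> 0 < t < 1 -> 0 < cfrac_tail s t < 1.
Proof.
elim: s => //= a s IH /andP[a0 sp] t01; have /andP[x0 _] := IH sp t01.
have a1 : (1 : R) <= a%:R by rewrite ler1n.
rewrite invr_gt0 invf_lt1 ?addr_gt0 //; lra.
Qed.

Lemma cfrac_itv (R : realType) s :
  all (fun x => 0 < x)%N s -> 0 <= cfrac R s <= 1.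
Proof.
elim: s => [|a s IH] /=; first by rewrite lexx ler01.
move=> /andP[a0 /IH /andP[x0 _]].
have a1 : (1 : R) <= a%:R by rewrite ler1n.
have s0 : 0 < a%:R + cfrac R s by lra.
by rewrite ltW ?invr_gt0 //= invf_le1 //; lra.
Qed.

(** This makes [a0] the integer part of a number given by a normalised finite
    expansion. *)
Lemma cfrac_normalised_itv (R : realType) s :
  all (fun x => 0 < x)%N s -> (1 < last 2 s)%N ->
  0 <= cfrac R s < 1 /\ (s != [::] -> 0 < cfrac R s).
Proof.
elim: s => [|a s IH] /=; first by rewrite lexx ltr01.
move=> /andP[a0 sp] la.
have a1 : (1 : R) <= a%:R by rewrite ler1n.
have : 1 < a%:R + cfrac R s.
  case: s IH sp la => [|b s] IH sp la.
    by rewrite /= addr0 ltr1n.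
  have [_ /(_ isT)] := IH sp la; lra.
move=> gt1; have gt0 : 0 < a%:R + cfrac R s by lra.
by rewrite ltW ?invr_gt0 //= invf_lt1.
Qed.

(** The two-term recurrence shared by numerators and denominators; only the
    initial pair, of indices 0 and -1, differs. The primed projections below
    are the values of the preceding index. *)
Fixpoint continuants (z : nat * nat) (a : nat -> nat) (n : nat) : nat * nat :=
  if n is k.+1 then
    let: (x, y) := continuants z a k in ((a n * x + y)%N, x)
  else z.

Definition den a n := (continuants (1, 0) a n).1.
Definition den' a n := (continuants (1, 0) a n).2.
Definition numer a n := (continuants (0, 1) a n).1.
Definition numer' a n := (continuants (0, 1) a n).2.

Lemma denS a n : den a n.+1 = (a n.+1 * den a n + den' a n)%N.
Proof. by rewrite /den /den' /=; case: continuants. Qed.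
Lemma den'S a n : den' a n.+1 = den a n.
Proof. by rewrite /den /den' /=; case: continuants. Qed.
Lemma numerS a n : numer a n.+1 = (a n.+1 * numer a n + numer' a n)%N.
Proof. by rewrite /numer /numer' /=; case: continuants. Qed.
Lemma numer'S a n : numer' a n.+1 = numer a n.
Proof. by rewrite /numer /numer' /=; case: continuants. Qed.

Lemma den_gt0 {a n} : positive_upto a n -> (0 < den a n)%N.
Proof.
elim: n => // n IH apos; rewrite denS.
have := IH (positive_uptoW (leqnSn n) apos); have := apos n.+1; nia.
Qed.

(** Crude, but enough for the convergence of continued fractions. *)
Lemma den_ge {a n} : positive_upto a n -> (n <= den a n)%N.
Proof.
elim/ltn_ind: n => -[//|[|n]] IH apos.
  exact: den_gt0.
have a0 := apos n.+2; rewrite denS den'S.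
have := IH n.+1 (ltnSn _) (positive_uptoW (leqnSn _) apos).
have /den_gt0 := positive_uptoW (leq_trans (leqnSn n) (leqnSn _)) apos.
nia.
Qed.

Lemma den'_le_den {a n} : positive_upto a n -> (den' a n <= den a n)%N.
Proof.
case: n => // n apos; rewrite denS den'S; have := apos n.+1; nia.
Qed.

Lemma den_mono {a n} : positive_upto a n.+1 -> (den a n <= den a n.+1)%N.
Proof. by move=> /den'_le_den; rewrite den'S. Qed.

Lemma cfrac_tailE (R : realType) a n (t : R) : positive_upto a n -> 0 <= t ->
  cfrac_tail (digits a n) t =
  ((numer a n)%:R + t * (numer' a n)%:R) / ((den a n)%:R + t * (den' a n)%:R).
Proof.
elim: n t => [|n IH] t apos t0.
  rewrite /den /den' /numer /numer' /=; field; lra.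
have an : (1 : R) <= (a n.+1)%:R by rewrite ler1n apos //=.
have q0 : (1 : R) <= (den a n)%:R.
  by rewrite ler1n; apply: den_gt0; apply: positive_uptoW apos.
have q'0 : (0 : R) <= (den' a n)%:R by rewrite ler0n.
have s0 : 0 < (a n.+1)%:R + t by lra.
rewrite digitsS cfrac_tail_rcons IH ?invr_ge0 1?ltW //; last first.
  exact: positive_uptoW apos.
rewrite denS den'S numerS numer'S !natrD !natrM; field.
apply/andP; split; last lra.
rewrite gt_eqF //; nra.
Qed.

Lemma continuants_det (R : realType) a n :
  (numer' a n)%:R * (den a n)%:R - (numer a n)%:R * (den' a n)%:R =
  (-1) ^+ n :> R.
Proof.
elim: n => [|n IH]; first by rewrite /den /den' /numer /numer' /= expr0; ring.
by rewrite exprS -IH denS den'S numerS numer'S !natrD !natrM; ring.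
Qed.

(** The whole analysis of the algorithm rests on this exact error term; its
    sign is the determinant of the continuants. *)
Lemma cfrac_tail_convergent {R : realType} {a n} {t : R} :
  positive_upto a n -> 0 <= t ->
  cfrac_tail (digits a n) t = convergent R a n +
  (-1) ^+ n * (t / ((den a n)%:R * ((den a n)%:R + t * (den' a n)%:R))).
Proof.
move=> apos t0; rewrite cfrac_tailE //.
rewrite -[convergent R a n]/(cfrac_tail (digits a n) 0) cfrac_tailE //.
rewrite -(continuants_det R a n).
have q0 : (1 : R) <= (den a n)%:R by rewrite ler1n den_gt0.
have q'0 : (0 : R) <= (den' a n)%:R by rewrite ler0n.
field; rewrite !gt_eqF //; nra.
Qed.

Lemma cfrac_tail_dist (R : realType) a n (t : R) :
  positive_upto a n -> 0 <= t <= 1 ->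
  `|cfrac_tail (digits a n) t - convergent R a n| <= (den a n)%:R^-1.
Proof.
move=> apos /andP[t0 t1]; rewrite (cfrac_tail_convergent apos t0).
rewrite [_ + _ - _]addrAC subrr add0r.
rewrite normrM normrX normrN1 expr1n mul1r.
have q0 : (1 : R) <= (den a n)%:R by rewrite ler1n den_gt0.
have q'0 : (0 : R) <= (den' a n)%:R by rewrite ler0n.
have tq : 0 <= t * (den' a n)%:R by rewrite mulr_ge0.
have D0 : 0 < (den a n)%:R * ((den a n)%:R + t * (den' a n)%:R) by nra.
rewrite ger0_norm; last by rewrite divr_ge0 // ltW.
rewrite ler_pdivrMr // mulrA mulVf ?mul1r ?gt_eqF; lra.
Qed.

(** The bound [cfrac_tail_dist] is uniform in the remainder. *)
Lemma convergent_cvg (R : realType) a (x : R) (t : nat -> R) :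
  (forall i, (0 < i)%N -> (0 < a i)%N) ->
  (forall n, 0 <= t n <= 1) ->
  (forall n, x = cfrac_tail (digits a n) (t n)) ->
  convergent R a n @[n --> \oo] --> x.
Proof.
move=> apos t01 xE; apply/cvgrPdist_le => /= e e0.
near=> n.
have apn := positive_all a n apos.
rewrite {1}(xE n) (le_trans (cfrac_tail_dist _ _ _ _ apn (t01 n))) //.
have q0 : (0 : R) < (den a n)%:R by rewrite ltr0n den_gt0.
have nq : (n%:R : R) <= (den a n)%:R by rewrite ler_nat den_ge.
have ne : e^-1 <= n%:R by near: n; exact: nbhs_infty_ger.
rewrite -[e]invrK lef_pV2 ?posrE ?invr_gt0 //; exact: le_trans nq.
Unshelve. all: by end_near. Qed.

Lemma convergentD (R : realType) a n k :
  convergent R a (n + k) =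
  cfrac_tail (digits a n) (cfrac R [seq a i | i <- iota n.+1 k]).
Proof.
by rewrite /convergent /cfrac iotaD map_cat foldr_cat add1n.
Qed.

(** All convergents of order at least [n] lie in the image of [0, 1] under the
    [n]-th tail map, so they form a Cauchy sequence. *)
Lemma convergent_is_cvg (R : realType) a :
  (forall i, (0 < i)%N -> (0 < a i)%N) -> cvgn (convergent R a).
Proof.
move=> apos; apply/cauchy_cvgP/cauchy_exP => e e0.
have [N Ne] : exists N, 2 * e^-1 <= N%:R :> R.
  by exists (Num.Def.trunc (2 * e^-1)).+1; rewrite ltW // truncnS_gt.
have apn := positive_all a N apos.
have q0 : (0 : R) < (den a N)%:R by rewrite ltr0n den_gt0.
have nq : (N%:R : R) <= (den a N)%:R by rewrite ler_nat den_ge.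
exists (convergent R a N); exists N => //= m /= Nm.
rewrite -(subnKC Nm) /ball /= convergentD distrC.
apply: le_lt_trans (cfrac_tail_dist _ _ _ _ apn _) _.
  apply: cfrac_itv; apply/allP => _ /mapP[i + ->].
  rewrite mem_iota => ?; apply: apos; lia.
have ei : 0 < e^-1 by rewrite invr_gt0.
rewrite -[e]invrK ltf_pV2 ?posrE //; lra.
Qed.

(** * Partial quotients and the Gauss map *)

Definition gauss {R : realType} (x : R) : R := x^-1 - (Num.truncn x^-1)%:R.

Lemma gauss_cons (R : realType) (a : nat) (x : R) : 0 <= x < 1 ->
  Num.truncn (a%:R + x) = a /\ gauss (a%:R + x)^-1 = x.
Proof.
move=> x01; rewrite /gauss invrK (@truncn_def _ _ a).
  by split=> //; ring.
by rewrite -natr1; lra.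
Qed.

Lemma gauss_itv (R : realType) (x : R) : 0 < x -> 0 <= gauss x < 1.
Proof.
move=> x0; have /truncn_itv : 0 <= x^-1 by rewrite invr_ge0 ltW.
by rewrite /gauss -natr1; lra.
Qed.

Lemma int_bound0 (R : realType) (z : int) : -1 < (z%:~R : R) < 1 -> z = 0.
Proof.
have -> : (-1 : R) = (-1 : int)%:~R by [].
by rewrite -[X in _ && (_ < X)]/((1 : int)%:~R : R) !ltr_int; lia.
Qed.

Lemma convergent_cons (R : realType) a n :
  convergent R a n.+1 = ((a 1%N)%:R + convergent R (a \o succn) n)^-1.
Proof. by rewrite /convergent -/(digits a n.+1) digits_cons. Qed.

(** Strictness is what separates infinite expansions from finite ones: the
    remainder never vanishes. The lower bound holds for every positive
    sequence, and applied to the shifted sequence it yields the upper one. *)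
Lemma infinite_tail (R : realType) (a : nat -> nat) (x : R) :
  (forall i, (0 < i)%N -> (0 < a i)%N) ->
  convergent R a n @[n --> \oo] --> x ->
  0 < x < 1 /\
  convergent R (a \o succn) n @[n --> \oo] --> x^-1 - (a 1%N)%:R.
Proof.
have tail b y : (forall i, (0 < i)%N -> (0 < b i)%N) ->
  convergent R b n @[n --> \oo] --> y ->
  0 < y /\ convergent R (b \o succn) n @[n --> \oo] --> y^-1 - (b 1%N)%:R.
  move=> bpos cvb; have y0 : 0 < y.
    apply: (@lt_le_trans _ _ ((b 1%N)%:R + 1)^-1).
      by rewrite invr_gt0 natr1 ltr0n.
    have := cvb; rewrite -cvg_shiftS => /cvgr_to_ge; apply.
    near=> n; rewrite /= convergent_cons.
    have /andP[c0 c1] : 0 <= convergent R (b \o succn) n <= 1.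
      by apply: cfrac_itv; apply: positive_digits => i _; apply: bpos.
    have b1 : (1 : R) <= (b 1%N)%:R by rewrite ler1n bpos.
    rewrite lef_pV2 ?posrE; lra.
  split=> //.
  have -> : (fun n => convergent R (b \o succn) n) =
            (fun n => (convergent R b n.+1)^-1 - (b 1%N)%:R).
    by apply/funext => n; rewrite convergent_cons invrK; ring.
  apply: cvgB; last exact: cvg_cst.
  apply: cvgV; first by rewrite gt_eqF.
  by move: cvb; rewrite -cvg_shiftS.
move=> apos cva; have [x0 cva'] := tail _ _ apos cva.
split=> //; rewrite x0 /=.
have [] := tail _ _ _ cva'; first by move=> i _; apply: apos.
have a1 : (1 : R) <= (a 1%N)%:R by rewrite ler1n apos.
by move=> x'0 _; rewrite -invf_gt1 //; lra.
Unshelve. all: by end_near. Qed.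

Lemma infinite_expansion_itv (R : realType) (x : R) a0 a :
  infinite_expansion x a0 a ->
  0 < x - a0%:~R < 1 /\ convergent R a n @[n --> \oo] --> x - a0%:~R.
Proof.
move=> [apos cva]; have cva' : convergent R a n @[n --> \oo] --> x - a0%:~R.
  have -> : convergent R a = (fun n => a0%:~R + convergent R a n - a0%:~R).
    by apply/funext => n; ring.
  by apply: cvgB => //; exact: cvg_cst.
by split=> //; have [] := infinite_tail _ _ _ apos cva'.
Qed.

Lemma finite_expansion_unit (R : realType) (x : R) a0 s : 0 <= x < 1 ->
  finite_expansion x a0 s ->
  [/\ a0 = 0, all (fun a => 0 < a)%N s, x = cfrac R s & (1 < last 2 s)%N].
Proof.
move=> x01 [sp xE]; rewrite lt_eqF; last by case/andP: x01.
move=> la; have [c01 _] := cfrac_normalised_itv R s sp la.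
have a00 : a0 = 0 by apply: (int_bound0 R); lra.
by split=> //; rewrite xE a00 add0r.
Qed.

(** The Gauss map shifts partial quotients; by iteration this makes them
    unique, whichever kind of expansion they are read from. *)
Lemma partial_quotient_gauss (R : realType) (x : R) n m : 0 < x < 1 ->
  partial_quotient x n.+1 m ->
  if n is 0 then m = Num.truncn x^-1 else partial_quotient (gauss x) n m.
Proof.
move=> x01 [_ [[a0 [s [fe sz mE]]]|[a0 [a [ie mE]]]]].
  have x01' : 0 <= x < 1 by lra.
  have [_ sp xE la] := finite_expansion_unit _ _ _ _ x01' fe.
  case: s {fe} sz mE sp xE la => // a s sz mE /andP[apos sp] xE la.
  have la' : (1 < last 2 s)%N by case: s la {sz mE sp xE}.
  have [c01 _] := cfrac_normalised_itv R s sp la'.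
  have [ta ga] := gauss_cons _ a _ c01.
  rewrite xE cfrac_cons; case: n sz mE => [|n] sz mE.
    by rewrite invrK ta mE.
  rewrite ga; split=> //; left; exists 0, s.
  split=> //; split=> //; first by rewrite add0r.
  by rewrite lt_eqF //; case/andP: c01.
have [xa cva] := infinite_expansion_itv _ _ _ _ ie.
have a00 : a0 = 0 by apply: (int_bound0 R); lra.
case: ie => apos _; rewrite a00 subr0 in cva.
have [_ cva1] := infinite_tail _ _ _ apos cva.
have apos1 i : (0 < i)%N -> (0 < (a \o succn) i)%N by move=> _; apply: apos.
have [x'01 _] := infinite_tail _ _ _ apos1 cva1.
have x'01' : 0 <= x^-1 - (a 1%N)%:R < 1 by lra.
have [ta ga] := gauss_cons _ (a 1%N) _ x'01'.
rewrite subrKC in ta; rewrite subrKC invrK in ga.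
case: n mE => [|n] mE; first by rewrite mE ta.
rewrite ga; split=> //; right; exists 0, (a \o succn); split=> //.
by split=> //; rewrite (_ : (fun n => _) = convergent R (a \o succn)) //;
   apply/funext => k; rewrite add0r.
Qed.

(** Converse of the shift, which builds expansions from the left. *)
Lemma partial_quotient_cons (R : realType) (a : nat) (x : R) n m :
  (0 < a)%N -> 0 < x < 1 ->
  partial_quotient x n m -> partial_quotient (a%:R + x)^-1 n.+1 m.
Proof.
move=> a0 x01 [n0 pq]; split=> //.
have a1 : (1 : R) <= a%:R by rewrite ler1n.
case: pq => [[z [s [fe sz mE]]]|[z [b [ie mE]]]].
  have x01' : 0 <= x < 1 by lra.
  left; have [_ sp xE la] := finite_expansion_unit _ _ _ _ x01' fe.
  exists 0, (a :: s); split=> //; last by case: n n0 sz mE.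
  split; first by rewrite /= a0.
    by rewrite add0r xE.
  rewrite lt_eqF; last by rewrite invf_lt1; lra.
  by case: s sz la {mE fe sp xE} => //; case: n n0.
right; have [xa cvb] := infinite_expansion_itv _ _ _ _ ie.
have z0 : z = 0 by apply: (int_bound0 R); lra.
rewrite z0 subr0 in cvb; have [bpos _] := ie.
exists 0, (fun i => if i is k.+2 then b k.+1 else a); split; last first.
  by case: n n0 mE.
split; first by case=> [|[|k]] // _; exact: bpos.
rewrite -cvg_shiftS /=.
rewrite (_ : (fun n => _) = (fun n => (a%:R + convergent R b n)^-1)).
  apply: cvgV; first by rewrite gt_eqF //; lra.
  by apply: cvgD => //; exact: cvg_cst.
apply/funext => k; rewrite add0r convergent_cons; congr (_ + _)^-1.
rewrite /convergent; congr cfrac; apply/eq_in_map => i.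
by rewrite mem_iota; case: i.
Qed.

Lemma iter_gaussE (R : realType) (x : R) n : 0 < x < 1 ->
  (forall k, (k < n)%N -> 0 < iter k gauss x) ->
  let a i := Num.truncn (iter i.-1 gauss x)^-1 in
  x = cfrac_tail (digits a n) (iter n gauss x).
Proof.
move=> x01 gpos a; elim: n gpos => // n IH gpos.
rewrite digitsS cfrac_tail_rcons {1}IH; last by move=> k kn; apply: gpos; lia.
by congr cfrac_tail; rewrite iterS /a /= /gauss subrKC invrK.
Qed.

(** An orbit of the Gauss map that reaches zero produces a finite expansion;
    its last partial quotient exceeds 1 because the last nonzero point of the
    orbit is the inverse of an integer and less than 1. *)
Lemma iter_gauss_finite (R : realType) (x : R) k : 0 <= x < 1 ->
  iter k gauss x = 0 -> exists s, finite_expansion x 0 s.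
Proof.
elim: k x => [|k IH] x x01.
  move=> /= ->; exists [::]; split=> //=; first by rewrite addr0.
  by rewrite eq_sym oner_eq0.
rewrite iterSr; have [->|xn0] := eqVneq x 0.
  move=> _; exists [::]; split=> //=; first by rewrite addr0.
  by rewrite eq_sym oner_eq0.
have x0 : 0 < x by rewrite lt0r xn0; case/andP: x01.
have x1 : 1 < x^-1 by rewrite invf_gt1 //; lra.
have g01 := gauss_itv _ _ x0.
move=> /(IH _ g01)[s fe].
have [_ sp gE la] := finite_expansion_unit _ _ _ _ g01 fe.
exists (Num.truncn x^-1 :: s); split.
- by rewrite /= sp truncn_gt0 ltW.
- by rewrite add0r cfrac_cons -gE /gauss subrKC invrK.
rewrite lt_eqF; last by case/andP: x01.
case: s gE {fe sp} la => //= gE _; rewrite truncn_gt_nat.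
have t1 : (1 <= Num.truncn x^-1)%N by rewrite truncn_gt0 ltW.
move: gE x1; rewrite /gauss => /eqP; rewrite subr_eq0 => /eqP xE.
by rewrite xE ltr1n ler_nat.
Qed.

Lemma expansion_exists (R : realType) (x : R) : 0 < x < 1 ->
  (exists s, finite_expansion x 0 s) \/ (exists a, infinite_expansion x 0 a).
Proof.
move=> x01; have [[k gk]|nk] := pselect (exists k, iter k gauss x = 0).
  by left; apply: iter_gauss_finite gk; lra.
right; have g01 k : 0 < iter k gauss x < 1.
  elim: k => // k IH; have gk0 : iter k.+1 gauss x != 0.
    by apply/eqP => gk; apply: nk; exists k.+1.
  have /andP[g0 ->] := gauss_itv _ _ (proj1 (andP IH)).
  by rewrite andbT lt0r gk0.
exists (fun i => Num.truncn (iter i.-1 gauss x)^-1); split.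
  move=> i _; rewrite truncn_gt0 ltW // invf_gt1; have := g01 i.-1; lra.
rewrite (_ : (fun n => _) =
  convergent R (fun i => Num.truncn (iter i.-1 gauss x)^-1)); last first.
  by apply/funext => n; rewrite add0r.
apply: (@convergent_cvg _ _ _ (fun n => iter n gauss x)).
- move=> i _; rewrite truncn_gt0 ltW // invf_gt1; have := g01 i.-1; lra.
- by move=> n; have := g01 n; lra.
- by move=> n; apply: iter_gaussE => // k _; have := g01 k; lra.
Qed.

Lemma partial_quotient1 (R : realType) (x : R) : 0 < x < 1 ->
  partial_quotient x 1 (Num.truncn x^-1).
Proof.
move=> x01; have [m pq] : exists m, partial_quotient x 1 m.
  have [[s fe]|[a ie]] := expansion_exists _ _ x01; last first.
    by exists (a 1%N); split=> //; right; exists 0, a.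
  exists (nth 0%N s 0); split=> //; left; exists 0, s; split=> //.
  case: s fe => // -[_ xE _]; move: xE x01; rewrite addr0 => ->; lra.
by rewrite -(partial_quotient_gauss _ _ 0%N _ x01 pq).
Qed.

(** The Gauss map peels off the prefix [s] in both directions, which reduces
    the claim to the first partial quotient of [1 / y]. *)
Lemma partial_quotient_tail (R : realType) s (y : R) m :
  all (fun a => 0 < a)%N s -> 1 < y ->
  partial_quotient (cfrac_tail s y^-1) (size s).+1 m <-> m = Num.truncn y.
Proof.
move=> sp y1; have y01 : 0 < y^-1 < 1 by rewrite invr_gt0 invf_lt1; lra.
elim: s sp => [_|a s IH /andP[a0 sp]].
  split=> [pq|->].
    by rewrite (partial_quotient_gauss _ _ 0%N _ y01 pq) invrK.
  by have := partial_quotient1 _ _ y01; rewrite invrK.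
have t01 := cfrac_tail_itv R s _ sp y01.
rewrite -(IH sp) cfrac_tail_cons; split; last first.
  exact: partial_quotient_cons.
have at01 : 0 < (a%:R + cfrac_tail s y^-1)^-1 < 1.
  have a1 : (1 : R) <= a%:R by rewrite ler1n.
  rewrite invr_gt0 invf_lt1; lra.
move=> /(partial_quotient_gauss _ _ (size s).+1 _ at01).
have t01' : 0 <= cfrac_tail s y^-1 < 1 by lra.
by have [_ ->] := gauss_cons R a _ t01'.
Qed.

(** The convention 1 = [0; 1] makes the complete quotient 1 admissible when no
    partial quotient precedes it. *)
Lemma partial_quotient_of_one (R : realType) m :
  partial_quotient (1 : R) 1 m <-> m = 1%N.
Proof.
split=> [|->]; last first.
  split=> //; left; exists 0, [:: 1%N]; split=> //; split=> //=.
    by rewrite add0r addr0 invr1.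
  by rewrite eqxx.
move=> [_ [[a0 [s [[_ _ +] _ ->]]]|[a0 [a [ie _]]]]].
  by rewrite eqxx => -[_ ->].
have [a01 _] := infinite_expansion_itv _ _ _ _ ie.
have a0E : 1 - a0 = 0 by apply: (int_bound0 R); rewrite intrB; lra.
by move: a01; rewrite -[1 - _](intrB _ 1) a0E ltxx.
Qed.

(** * Growth of the denominators *)

Definition ratio {R : realType} (b c : nat -> nat) (n : nat) : R :=
  (den c n + den' c n)%:R / (den b n)%:R.

(** The numerator of the increment of [ratio], kept as an integer so that
    strict inequalities have size at least one. *)
Definition drift (b c : nat -> nat) (n : nat) : int :=
  (den c n.+1 + den c n)%:Z * (den b n)%:Z -
  (den c n + den' c n)%:Z * (den b n.+1)%:Z.

(** The drift is a Casoratian of two second-order recurrences. If both had the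
    same constant coefficient it would alternate in sign; the bracket measures
    how far the coefficients are from that situation. *)
Lemma driftD b c n :
  drift b c n.+1 + drift b c n =
  (den b n.+1)%:Z * (((c n.+2)%:Z - (b n.+2)%:Z) * (den c n.+1)%:Z +
                     ((c n.+1)%:Z - (b n.+2)%:Z) * (den c n)%:Z).
Proof.
by rewrite /drift !(denS, den'S) !(PoszD, PoszM); ring.
Qed.

Lemma ratioB {R : realType} {b c n} : positive_upto b n.+1 ->
  ratio b c n.+1 - ratio b c n =
  (drift b c n)%:~R / ((den b n)%:R * (den b n.+1)%:R) :> R.
Proof.
move=> bpos; have r'0 : (0 : R) < (den b n.+1)%:R by rewrite ltr0n den_gt0.
have r0 : (0 : R) < (den b n)%:R.
  by rewrite ltr0n den_gt0 //; apply: positive_uptoW bpos.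
rewrite /ratio /drift den'S rmorphB !rmorphM /= -!pmulrn !natrD.
by field; rewrite !gt_eqF.
Qed.

(** If [c (n+2) < b (n+2)], a positive bracket in [driftD] would require
    [c (n+1) * den c n > den c (n+1)], against the recurrence. *)
Lemma drift_dominates b c n : positive_upto b n -> positive_upto c n ->
  (forall k, (k < n)%N -> 0 < drift b c k) ->
  forall i, (0 < i <= n)%N -> (b i <= c i)%N.
Proof.
move=> bpos cpos dpos [//|[|i]] /andP[_ ilen].
  have := dpos 0%N ilen; rewrite /drift /den /den' /=; lia.
have D := driftD b c i.
have d1 := dpos i.+1 ilen; have d0 := dpos i (ltnW ilen).
have /den_gt0 r0 := positive_uptoW (ltnW ilen) bpos.
have /den_gt0 q0 := positive_uptoW (ltnW (ltnW ilen)) cpos.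
have := denS c i.
have q'0 := den'_le_den (positive_uptoW (ltnW (ltnW ilen)) cpos).
rewrite leqNgt => qE; apply/negP => lt.
have S0 : 0 < ((c i.+2)%:Z - (b i.+2)%:Z) * (den c i.+1)%:Z +
          ((c i.+1)%:Z - (b i.+2)%:Z) * (den c i)%:Z.
  by rewrite -(pmulr_rgt0 _ (_ : 0 < (den b i.+1)%:Z)) // -D addr_gt0.
nia.
Qed.

Lemma bounded_increments (R : realType) (u : nat -> R) (M e : R) :
  {homo u : m n / (m <= n)%N >-> m <= n} -> (forall n, u n <= M) -> 0 < e ->
  exists N, forall n, (N <= n)%N -> u n.+1 - u n <= e.
Proof.
move=> und ule e0.
have cu : cvgn u by apply: nondecreasing_is_cvgn => //; exists M => _ [n _ <-].
have /cvgrPdist_le/(_ e e0)[N _ Ne] := cu.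
exists N => n /Ne /=; have := nondecreasing_cvgn_le und cu n.+1.
have := nondecreasing_cvgn_le und cu n => l1 l2.
by rewrite ger0_norm; lra.
Qed.

Section Growth.
Variables b c : nat -> nat.
Hypothesis bpos : forall i, (0 < i)%N -> (0 < b i)%N.
Hypothesis cpos : forall i, (0 < i)%N -> (0 < c i)%N.
Hypothesis drift_gt0 : forall n, 0 < drift b c n.
Hypothesis den_quad : forall n,
  (den b n.+1 * den b n.+1 <=
   den c n * (den c n.+1 + den c n) + den b n.+1 * den b n)%N.

Let r_gt0 n : (0 < den b n)%N := den_gt0 (positive_all b n bpos).
Let q_gt0 n : (0 < den c n)%N := den_gt0 (positive_all c n cpos).

Lemma den_le n : (den b n <= den c n)%N.
Proof.
have bc : forall i, (0 < i)%N -> (b i <= c i)%N.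
  move=> i i0; apply: (drift_dominates b c i) => //; try exact: positive_all.
  by rewrite i0 leqnn.
elim/ltn_ind: n => -[//|[|n]] IH.
  by have := bc 1%N isT; rewrite !denS /den /den' /=; lia.
by rewrite denS den'S (denS c) den'S leq_add ?leq_mul ?bc ?IH.
Qed.

Lemma ratio_nd (R : realType) :
  {homo @ratio R b c : m n / (m <= n)%N >-> m <= n}.
Proof.
apply: homo_leq => [x //|x y z|n]; first exact: le_trans.
rewrite -subr_ge0 ratioB; last exact: positive_all.
by rewrite divr_ge0 ?mulr_ge0 ?ler0n // ler0z ltW.
Qed.

Section Bounded.
Variable H : nat.
Hypothesis bounded : forall n, (den c n + den' c n < H * den b n)%N.

Lemma bounded_den n : (den b n.+1 <= H.+1 * den c n)%N.
Proof.
have := bounded n.+1; have := den_quad n; rewrite den'S.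
have := den_le n; have := r_gt0 n.+1.
set r := den b n; set r' := den b n.+1; set q := den c n; set q' := den c n.+1.
move=> r'0 rq quad bd.
have : (r' * r' <= r' * (q * H + r))%N by nia.
rewrite leq_pmul2l //; lia.
Qed.

Lemma bounded_den_c n : (den c n.+1 <= H * H.+1 * den c n)%N.
Proof.
have := bounded n.+1; have := bounded_den n; nia.
Qed.

(** The increments of [ratio] tend to zero, as it is monotone and bounded. *)
Lemma bounded_drift (R : realType) K : exists N, forall n, (N <= n)%N ->
  K.+1%:Z * drift b c n <= (den b n)%:Z * (den b n.+1)%:Z.
Proof.
have [n||N NP] := bounded_increments R (ratio b c) H%:R K.+1%:R^-1 (ratio_nd R).
- rewrite ler_pdivrMr ?ltr0n // -natrM ler_nat; exact: ltnW.
- by rewrite invr_gt0 ltr0n.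
exists N => n /NP; rewrite ratioB; last exact: positive_all.
rewrite ler_pdivrMr ?mulr_gt0 ?ltr0n // ler_pdivlMl ?ltr0n //.
by rewrite -(ler_int R) !rmorphM.
Qed.

(** [S] stands for the bracket of [driftD], [A] and [B] for its coefficients:
    small drifts force [0 < S < den c n], hence [A >= 1] and [B < 0]. *)
Lemma bounded_absurd (R : realType) : False.
Proof.
(* With r and q the denominators: r_(n+2) <= H.+1 * q_(n+1), q_(n+1) <=
   H * H.+1 * q_n and r_n <= q_n, so that r_(n+2) + r_n <= K * q_n. *)
pose K := (H.+1 * (H * H.+1) + 1)%N.
have [N NP] := bounded_drift R K.
have incr n : (N <= n)%N -> (c n.+1 < c n.+2)%N.
  move=> Nn; have e0 := NP _ Nn; have e1 := NP _ (leqW Nn).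
  have d0 := drift_gt0 n; have d1 := drift_gt0 n.+1.
  have := driftD b c n.
  set A := (c n.+2)%:Z - (b n.+2)%:Z; set B := (c n.+1)%:Z - (b n.+2)%:Z.
  set S := A * _ + _ => SE.
  have r0 : 0 < (den b n.+1)%:Z := r_gt0 n.+1.
  have S0 : 0 < S by rewrite -(pmulr_rgt0 _ r0) -SE addr_gt0.
  have r2 : (den b n.+2 + den b n <= K * den c n)%N.
    have := bounded_den n.+1; have := bounded_den_c n; have := den_le n.
    rewrite /K; nia.
  have SK : K.+1%:Z * S <= (den b n.+2 + den b n)%:Z.
    by rewrite -(ler_pM2l r0) mulrCA -SE PoszD; lia.
  have Sq : S < (den c n)%:Z.
    rewrite -(ltr_pM2l (isT : 0 < K.+1%:Z)); apply: le_lt_trans SK _.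
    by rewrite -PoszM ltz_nat (leq_ltn_trans r2) // ltn_pmul2r.
  have A0 : 0 <= A.
    have := drift_dominates b c n.+2 (positive_all b _ bpos)
      (positive_all c _ cpos) (fun k _ => drift_gt0 k) n.+2; rewrite /A; lia.
  have qq : (den c n <= den c n.+1)%N := den_mono (positive_all c n.+1 cpos).
  have A1 : 1 <= A.
    rewrite -gtz0_ge1 lt0r A0 andbT; apply/eqP => A00.
    have q0 : 0 < (den c n)%:Z := q_gt0 n.
    move: S0 Sq; rewrite /S A00 mul0r add0r pmulr_lgt0 // gtr_pMl //; lia.
  have B0 : B < 0.
    rewrite ltNge; apply/negP => B0.
    have Bq : 0 <= B * (den c n)%:Z by rewrite mulr_ge0.
    have Aq : (den c n.+1)%:Z <= A * (den c n.+1)%:Z by rewrite ler_peMl.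
    by move: Sq; rewrite /S; lia.
  by move: A1 B0; rewrite /A /B; lia.
have cN k : (k < c (N + k).+2)%N.
  elim: k => [|k IH]; first exact: cpos.
  by rewrite addnS; apply: leq_ltn_trans (incr _ _) => //; lia.
have := bounded_den_c (N + H * H.+1).+1.
have := cN (H * H.+1)%N; have := q_gt0 (N + H * H.+1).+1.
rewrite (denS c (N + H * H.+1).+1); nia.
Qed.

End Bounded.

Lemma ratio_unbounded (R : realType) H : exists N, forall n, (N <= n)%N ->
  (H * den b n <= den c n + den' c n)%N.
Proof.
have [[N HN]|nN] :=
  pselect (exists N, H * den b N <= den c N + den' c N)%N; last first.
  exfalso; apply: (bounded_absurd H _ R) => n; rewrite ltnNge; apply/negP => le.
  by apply: nN; exists n.
exists N => n /(ratio_nd R) le.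
rewrite -(ler_nat R) natrM -ler_pdivlMr ?ltr0n //; apply: le_trans le.
by rewrite ler_pdivlMr ?ltr0n // -natrM ler_nat.
Qed.

End Growth.

(** * One round of the algorithm *)

(** The state of the algorithm after [n] rounds. The remainder [t = 1] occurs
    only before the first round, for [alpha = 1]. *)
Definition on_track {R : realType} (alpha : R) (b c : nat -> nat) (n : nat) :
    Prop :=
  [/\ positive_upto b n, positive_upto c n,
      forall k, (k < n)%N -> 0 < drift b c k
    & exists t : R, [/\ 0 <= t <= 1, (0 < n)%N -> t < 1
        & alpha = convergent R b n + cfrac_tail (digits c n) t]].

(** The [y] for which [q * (y * q + q') = W]; when [q] and [q'] are the last two
    denominators, replacing the remainder by [1 / y] moves the convergent by
    [1 / W]. *)
Definition complete_quotient {R : realType} (W q q' : R) : R :=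
  (W / q - q') / q.

Lemma complete_quotientE {R : realType} {W q q' : R} : 0 < q ->
  q * (complete_quotient W q q' * q + q') = W.
Proof. by move=> q0; rewrite /complete_quotient; field; rewrite gt_eqF. Qed.

Lemma cfrac_tail_complete_quotient {R : realType} {a n} {W : R} :
  positive_upto a n ->
  let y := complete_quotient W (den a n)%:R (den' a n)%:R in
  0 < y ->
  cfrac_tail (digits a n) y^-1 = convergent R a n + (-1) ^+ n * W^-1.
Proof.
move=> apos y y0; rewrite (cfrac_tail_convergent apos) ?invr_ge0 1?ltW //.
have q0 : (0 : R) < (den a n)%:R by rewrite ltr0n den_gt0.
have q'0 : (0 : R) <= (den' a n)%:R by rewrite ler0n.
have := @complete_quotientE _ W _ (den' a n)%:R q0; rewrite -/y => <-.
have yq : 0 < y * (den a n)%:R by rewrite mulr_gt0.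
by congr (_ + _ * _); field; rewrite !gt_eqF //; lra.
Qed.

Lemma den'_le b c n : (forall i, (0 < i <= n)%N -> (b i <= c i)%N) ->
  (den b n <= den c n)%N /\ (den' b n <= den' c n)%N.
Proof.
elim: n => // n IH bc; rewrite !denS !den'S.
have [|le le'] := IH; first by move=> i ?; apply: bc; lia.
by split=> //; rewrite leq_add // leq_mul // bc //= leqnn.
Qed.

(** What a round leaves for the asymptotic analysis, stated with the integer
    denominators and free of the remainders and rounding amounts. *)
Record round_facts {R : realType} (alpha : R) b c n : Prop := RoundFacts {
  round_drift : 0 < drift b c n;
  round_quad : (den b n.+1 * den b n.+1 <=
    den c n * (den c n.+1 + den c n) + den b n.+1 * den b n)%N;
  round_lower : (den c n * (den c n + den' c n) <= den b n * den b n.+1)%N;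
  round_error : `|alpha - convergent R b n - convergent R c n| *
    (den c n * (den c n + den' c n))%:R <= 1 }.

(** Here [s] is the amount by which the algorithm rounds up, [t] and [t'] are
    the remainders before and after the round. Eliminating [W] from the two
    quadratic relations leaves [s * q] times the drift as a sum of three
    nonnegative terms, one of them positive because [t' < 1]. *)
Lemma round_inequalities (R : realType) (r r' q q' r2 q2 s t t' W : R) :
  0 < r -> 0 < q -> 0 <= q' -> 0 < r2 ->
  0 < s <= 1 -> 0 < t <= 1 -> 0 <= t' < 1 ->
  W * t = q * (q + t * q') -> W = r * (r2 - s * r) ->
  q * (q2 + t' * q) * s = r2 * (r2 - s * r) ->
  [/\ 0 < (q2 + q) * r - (q + q') * r2,
      r2 * r2 <= q * (q2 + q) + r2 * r & q * (q + q') <= r * r2].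
Proof.
move=> r0 q0 q'0 r20 s01 t01 t'01 Wt WE VE.
have W1 : q * (q + q') <= W.
  have [t0 t1] := andP t01.
  rewrite -(ler_pM2r t0) Wt; have : 0 <= q * q * (1 - t) by rewrite !mulr_ge0; lra.
  nra.
have u0 : 0 < r2 - s * r.
  by rewrite -(pmulr_rgt0 _ r0) -WE (lt_le_trans _ W1) // mulr_gt0 //; lra.
have sr : 0 <= s * r by rewrite mulr_ge0; lra.
split.
- have qs : 0 < q * s by rewrite mulr_gt0 //; lra.
  rewrite -(pmulr_rgt0 _ qs).
  have -> : q * s * ((q2 + q) * r - (q + q') * r2) =
     r * r2 * (r2 - s * r) * (1 - s) + r * q * q * s * (1 - t') +
     s * r2 * (W - q * (q + q')).
    have -> : q * s * ((q2 + q) * r - (q + q') * r2) =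
      r * (q * (q2 + t' * q) * s) + r * q * q * s * (1 - t') -
      s * r2 * (q * (q + q')) by ring.
    by rewrite VE WE; ring.
  apply: ltr_wpDr; first by rewrite !mulr_ge0 //; lra.
  by apply: ltr_wpDl; [rewrite !mulr_ge0|rewrite !mulr_gt0]; lra.
- have X0 : 0 < q * (q2 + t' * q).
    have s0 : 0 < s by lra.
    by rewrite -(pmulr_lgt0 _ s0) VE mulr_gt0.
  have Xs : q * (q2 + t' * q) * s <= q * (q2 + t' * q) by rewrite ger_pMr; lra.
  have Xq : 0 <= q * q * (1 - t') by rewrite !mulr_ge0; lra.
  have rs : 0 <= r2 * r * (1 - s) by rewrite !mulr_ge0; lra.
  rewrite VE in Xs; nra.
- rewrite (le_trans W1) // WE ler_pM2l //; lra.
Qed.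

(** [y] is the complete quotient that determines [b (n+1)] and [z] the one that
    determines [c (n+1)], given that [b (n+1)] was chosen by the rule. The
    nesting lets the same lemma both analyse a given run and construct one. *)
Lemma round_step (R : realType) (alpha : R) b c n :
  on_track alpha b c n -> ~ shulga_stop alpha b c n ->
  exists y : R, [/\ 1 <= y, (0 < n)%N -> 1 < y,
    alpha - convergent R c n = cfrac_tail (digits b n) y^-1 &
    b n.+1 = (Num.truncn y).+1 -> exists z : R,
    [/\ 1 < z, alpha - convergent R b n.+1 = cfrac_tail (digits c n) z^-1 &
      c n.+1 = Num.truncn z ->
      on_track alpha b c n.+1 /\ round_facts alpha b c n]].
Proof.
move=> [bpos cpos dpos [t [t01 tlt alphaE]]] nstop.
have bc := drift_dominates b c n bpos cpos dpos.
have [rq rq'] := den'_le b c n bc.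
set r : R := (den b n)%:R; set r' : R := (den' b n)%:R.
set q : R := (den c n)%:R; set q' : R := (den' c n)%:R.
have r0 : 0 < r by rewrite ltr0n den_gt0.
have q0 : 0 < q by rewrite ltr0n den_gt0.
have r'0 : 0 <= r' by rewrite ler0n.
have q'0 : 0 <= q' by rewrite ler0n.
have le_rq : r <= q by rewrite ler_nat.
have le_rq' : r' <= q' by rewrite ler_nat.
have t0 : 0 < t.
  rewrite lt0r; have /andP[-> _] := t01; rewrite andbT.
  by apply/eqP => t0; apply: nstop; rewrite /shulga_stop alphaE t0.
pose W := q * (q + t * q') / t.
have Wt : W * t = q * (q + t * q') by rewrite /W; field; rewrite gt_eqF.
have tq' : 0 <= t * q' by rewrite mulr_ge0 // ltW.
have W0 : 0 < W by rewrite divr_gt0 // mulr_gt0 //; lra.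
have W1 : q * (q + q') <= W.
  have qt : 0 <= q * q * (1 - t) by rewrite !mulr_ge0; lra.
  by rewrite -(ler_pM2r t0) Wt; lra.
have alphaW : alpha = convergent R b n + convergent R c n + (-1) ^+ n * W^-1.
  rewrite alphaE (cfrac_tail_convergent cpos (ltW t0)) -/q -/q' addrA.
  by rewrite /W invf_div.
pose y := complete_quotient W r r'.
have yE : r * (y * r + r') = W := complete_quotientE r0.
(* The surplus of y over 1, cleared of denominators; it can
   vanish only if t = 1. *)
have y_ge : r * r * (y - 1) * t >= q * q * (1 - t).
  have -> : r * r * (y - 1) * t = (r * (y * r + r')) * t - r * (r + r') * t by ring.
  rewrite yE Wt; have -> : q * q * (1 - t) = q * q - q * q * t by ring.
  have : r * (r + r') <= q * (q + q') by rewrite ler_pM //; lra.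
  move=> /(ler_wpM2r (ltW t0)); nra.
have rrt : 0 < r * r * t by rewrite !mulr_gt0.
have y1 : 1 <= y.
  rewrite -subr_ge0 -(pmulr_rge0 _ rrt) mulrAC; apply: le_trans y_ge.
  by rewrite !mulr_ge0; lra.
have y1s : t < 1 -> 1 < y.
  move=> tl; rewrite -subr_gt0 -(pmulr_rgt0 _ rrt) mulrAC; apply: lt_le_trans y_ge.
  by rewrite !mulr_gt0; lra.
have y0 : 0 < y by lra.
exists y; split=> //; first by move=> n0; apply: y1s; apply: tlt.
  by rewrite (cfrac_tail_complete_quotient bpos y0) alphaW; ring.
move=> bE.
have bpos' : positive_upto b n.+1.
  by apply: positive_uptoS => //; rewrite bE.
set r2 : R := (den b n.+1)%:R.
have r2E : r2 = (b n.+1)%:R * r + r' by rewrite /r2 denS natrD natrM.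
have r20 : 0 < r2 by rewrite ltr0n den_gt0.
pose s := (b n.+1)%:R - y.
have s01 : 0 < s <= 1.
  have /truncn_itv : 0 <= y by rewrite ltW.
  by rewrite /s bE -natr1; lra.
have WE : W = r * (r2 - s * r) by rewrite -yE r2E /s; ring.
have u0 : 0 < r2 - s * r by rewrite -(pmulr_rgt0 _ r0) -WE.
pose V := r2 * (r2 - s * r) / s.
have s0 : 0 < s by lra.
have V0 : 0 < V by rewrite divr_gt0 // mulr_gt0.
(* Rounding y up to b (n+1) removes 1 / (r r2) from the error 1 / W. *)
have VW : V^-1 = W^-1 - (r * r2)^-1.
  rewrite /V WE; field; rewrite !gt_eqF //.
pose z := complete_quotient V q q'.
have zE : q * (z * q + q') = V := complete_quotientE q0.
have z1 : 1 < z.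
  have ltWV : W < V.
    by rewrite -ltf_pV2 ?posrE // VW gtrDl oppr_lt0 invr_gt0 mulr_gt0.
  have := le_lt_trans W1 ltWV.
  by rewrite -zE ltr_pM2l // ltrD2r ltr_pMl.
have z0 : 0 < z by lra.
have alphaZ : alpha - convergent R b n.+1 = cfrac_tail (digits c n) z^-1.
  rewrite (cfrac_tail_complete_quotient cpos z0) alphaW VW.
  rewrite -[convergent R b n.+1]/(cfrac_tail (digits b n.+1) 0) digitsS.
  rewrite cfrac_tail_rcons addr0 (cfrac_tail_convergent bpos) ?invr_ge0 ?ler0n //.
  rewrite -/r -/r'.
  have -> : (b n.+1)%:R^-1 / (r * (r + (b n.+1)%:R^-1 * r')) = (r * r2)^-1.
    have b0 : (0 : R) < (b n.+1)%:R by rewrite bE ltr0n.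
    have br : 0 < (b n.+1)%:R * r by rewrite mulr_gt0.
    by rewrite r2E; field; rewrite !gt_eqF //; lra.
  by ring.
exists z; split=> // cE.
have /andP[zc1 zc2] := truncn_itv (ltW z0).
rewrite -natr1 -cE in zc2; rewrite -cE in zc1.
have cpos' : positive_upto c n.+1.
  by apply: positive_uptoS => //; rewrite cE truncn_gt0 ltW.
set q2 : R := (den c n.+1)%:R.
have q2E : q2 = (c n.+1)%:R * q + q' by rewrite /q2 denS natrD natrM.
pose t' := z - (c n.+1)%:R.
have t'01 : 0 <= t' < 1 by rewrite /t'; lra.
have VE : q * (q2 + t' * q) * s = r2 * (r2 - s * r).
  rewrite q2E (_ : _ + _ + _ = z * q + q'); last by rewrite /t'; ring.
  by rewrite zE /V; field; rewrite gt_eqF.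
have t01' : 0 < t <= 1 by lra.
have [D quad low] := round_inequalities R r r' q q' r2 q2 s t t' W
  r0 q0 q'0 r20 s01 t01' t'01 Wt WE VE.
have D' : 0 < drift b c n.
  rewrite -(ltr0z R) /drift rmorphB !rmorphM /= -!pmulrn !natrD; exact: D.
split; split=> //.
- move=> k; rewrite ltnS leq_eqVlt => /orP[/eqP->//|]; exact: dpos.
- exists t'; split=> //; first by lra.
    by move=> _; lra.
  rewrite digitsS cfrac_tail_rcons.
  have -> : (c n.+1)%:R + t' = z by rewrite /t'; ring.
  by rewrite -alphaZ; ring.
- by rewrite -(ler_nat R) !(natrD, natrM).
- by rewrite -(ler_nat R) !(natrD, natrM).
- have -> : alpha - convergent R b n - convergent R c n = (-1) ^+ n * W^-1.
    by rewrite alphaW; ring.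
  rewrite normrM normrX normrN1 expr1n mul1r.
  rewrite ger0_norm; last by rewrite invr_ge0 ltW.
  by rewrite ler_pdivrMl // mulr1 natrM natrD -/q -/q'.
Qed.

(** * Runs of the algorithm *)

Lemma partial_quotient_next (R : realType) a n (y : R) m :
  positive_upto a n -> 1 <= y -> ((0 < n)%N -> 1 < y) ->
  partial_quotient (cfrac_tail (digits a n) y^-1) n.+1 m <-> m = Num.truncn y.
Proof.
move=> apos y1 y1s; have [yE|yn1] := eqVneq y 1; last first.
  have y1' : 1 < y by rewrite lt_neqAle eq_sym yn1.
  have := partial_quotient_tail R (digits a n) y m (positive_digits apos) y1'.
  by rewrite size_digits.
case: n y1s {apos} => [_|n /(_ isT)]; last by rewrite yE ltxx.
by rewrite yE /= invr1 truncn1; exact: partial_quotient_of_one.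
Qed.

Lemma on_track0 (R : realType) (alpha : R) b c :
  0 <= alpha <= 1 -> on_track alpha b c 0.
Proof.
move=> alpha01; split=> //; [by case=> // -[]..|].
by exists alpha; split=> //; rewrite /convergent /= add0r.
Qed.

Lemma shulga_step_facts (R : realType) (alpha : R) b c n :
  on_track alpha b c n -> ~ shulga_stop alpha b c n ->
  shulga_step alpha b c n ->
  on_track alpha b c n.+1 /\ round_facts alpha b c n.
Proof.
move=> tr nstop [[m pqb bE] pqc].
have [bpos cpos _ _] := tr.
have [y [y1 y1s yE next]] := round_step _ _ _ _ _ tr nstop.
rewrite yE in pqb; have /(partial_quotient_next _ _ _ _ _ bpos y1 y1s) mE := pqb.
rewrite mE in bE; have [z [z1 zE]] := next bE; apply.
by move: pqc; rewrite zE partial_quotient_next // ltW.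
Qed.

Lemma run_on_track (R : realType) (alpha : R) b c n :
  0 <= alpha <= 1 ->
  (forall k, (k < n)%N ->
    ~ shulga_stop alpha b c k /\ shulga_step alpha b c k) ->
  on_track alpha b c n.
Proof.
move=> alpha01; elim: n => [_|n IH run]; first exact: on_track0.
have tr : on_track alpha b c n by apply: IH => k kn; apply: run; exact: leqW.
have [nstop step] := run n (ltnSn n).
by have [] := shulga_step_facts _ _ _ _ _ tr nstop step.
Qed.

Section Construction.
Context {R : realType}.
Variable alpha : R.

(** Until the algorithm stops, [round_step] guarantees that the partial
    quotients it asks for exist, so that the default value is not reached. *)
Definition chosen_quotient (x : R) (n : nat) : nat :=
  xget 0%N [set m | partial_quotient x n m].

Lemma chosen_quotientP x n m : partial_quotient x n m ->
  partial_quotient x n (chosen_quotient x n).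
Proof. by move=> pq; apply: (xgetPex 0%N); exists m. Qed.

Definition shulga_round (st : seq nat * seq nat) : seq nat * seq nat :=
  let n := (size st.1).+1 in
  let bs := rcons st.1 (chosen_quotient (alpha - cfrac R st.2) n).+1 in
  (bs, rcons st.2 (chosen_quotient (alpha - cfrac R bs) n)).

Definition shulga_run (n : nat) := iter n shulga_round ([::], [::]).
Definition shulga_b (i : nat) := last 0%N (shulga_run i).1.
Definition shulga_c (i : nat) := last 0%N (shulga_run i).2.

Lemma shulga_runE n : shulga_run n = (digits shulga_b n, digits shulga_c n).
Proof.
elim: n => // n IH; rewrite /shulga_run iterS -/(shulga_run n) !digitsS.
have lastE : shulga_run n.+1 = shulga_round (shulga_run n) by [].
by rewrite /shulga_b /shulga_c lastE /shulga_round !last_rcons IH.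
Qed.

Lemma shulga_run_step n : on_track alpha shulga_b shulga_c n ->
  ~ shulga_stop alpha shulga_b shulga_c n ->
  shulga_step alpha shulga_b shulga_c n.
Proof.
move=> tr nstop; have [bpos cpos _ _] := tr.
have [y [y1 y1s yE next]] := round_step _ _ _ _ _ tr nstop.
have pqb : partial_quotient (alpha - convergent R shulga_c n) n.+1 (Num.truncn y).
  by rewrite yE partial_quotient_next.
have bE : shulga_b n.+1 =
    (chosen_quotient (alpha - convergent R shulga_c n) n.+1).+1.
  rewrite /shulga_b /shulga_run iterS -/(shulga_run n) shulga_runE.
  by rewrite /shulga_round last_rcons size_digits.
have cE : shulga_c n.+1 =
    chosen_quotient (alpha - convergent R shulga_b n.+1) n.+1.
  rewrite {1}/shulga_c /shulga_run iterS -/(shulga_run n) shulga_runE.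
  rewrite /shulga_round last_rcons size_digits.
  rewrite -[cfrac R (digits _ _)]/(convergent R _ _) -bE.
  by rewrite -digitsS.
have pqb' := chosen_quotientP _ _ _ pqb.
have mE := pqb'; rewrite yE partial_quotient_next // in mE.
split; first by exists (chosen_quotient (alpha - convergent R shulga_c n) n.+1).
have [|z [z1 zE _]] := next; first by rewrite bE yE mE.
rewrite cE; apply: (chosen_quotientP _ _ (Num.truncn z)).
by rewrite zE partial_quotient_next // ltW.
Qed.

Lemma shulga_run_valid n : 0 <= alpha <= 1 ->
  (forall k, (k < n)%N -> ~ shulga_stop alpha shulga_b shulga_c k) ->
  forall k, (k < n)%N ->
    ~ shulga_stop alpha shulga_b shulga_c k /\
    shulga_step alpha shulga_b shulga_c k.
Proof.
move=> alpha01 ns; elim/ltn_ind => k IH kn; split; first exact: ns.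
apply: shulga_run_step; last exact: ns.
apply: run_on_track => // i ik; apply: IH => //; exact: ltn_trans kn.
Qed.

End Construction.

Lemma shulga_decomposition_exists (R : realType) (alpha : R) :
  0 <= alpha <= 1 -> exists beta gamma, shulga_decomposition alpha beta gamma.
Proof.
move=> alpha01; pose b := shulga_b alpha; pose c := shulga_c alpha.
have [stops|never] := pselect (exists n, shulga_stop alpha b c n).
  have stops' : exists n, `[< shulga_stop alpha b c n >].
    by case: stops => n ?; exists n; exact/asboolP.
  case: (ex_minnP stops') => n /asboolP stop_n least.
  exists (convergent R b n), (convergent R c n), b, c; left; exists n.
  split=> //; apply: shulga_run_valid => // k kn stop_k.
  by have := least k (asboolT stop_k); rewrite leqNgt kn.
have run n : ~ shulga_stop alpha b c n /\ shulga_step alpha b c n.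
  apply: (@shulga_run_valid _ _ n.+1) => // k _ stop_k.
  by apply: never; exists k.
have tr n : on_track alpha b c n by apply: run_on_track.
have cvg_of a : (forall n, positive_upto a n) -> cvgn (convergent R a).
  by move=> apos; apply: convergent_is_cvg => i i0; apply: (apos i); rewrite i0 /=.
exists (limn (convergent R b)), (limn (convergent R c)), b, c; right.
by split=> //; apply: cvg_of => n; have [] := tr n.
Qed.

(** * Infinite runs *)

Lemma rational_cfrac (R : realType) s : rational (cfrac R s).
Proof.
elim: s => [|a s [x _ IH]]; first by exists 0 => //; rewrite rmorph0.
exists (a%:R + x)^-1 => //; by rewrite cfrac_cons -IH fmorphV rmorphD /= ratr_nat.
Qed.

Lemma convergent_den (R : realType) a n : positive_upto a n ->
  convergent R a n * (den a n)%:R = (numer a n)%:R.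
Proof.
move=> apos; rewrite -[convergent R a n]/(cfrac_tail (digits a n) 0).
rewrite cfrac_tailE // !mul0r !addr0 divfK //.
by rewrite pnatr_eq0 -lt0n den_gt0.
Qed.

Lemma rational_den (R : realType) (x : R) : rational x ->
  exists (Q : nat) (P : int), (0 < Q)%N /\ x * Q%:R = P%:~R.
Proof.
move=> /rationalP[P [[|Q] ->]].
  by exists 1%N, 0; rewrite invr0 mulr0 mul0r.
by exists Q.+1, P; rewrite divfK ?pnatr_eq0.
Qed.

Section InfiniteRun.
Context {R : realType}.
Variables (alpha : R) (b c : nat -> nat).
Hypothesis alpha01 : 0 <= alpha <= 1.
Hypothesis run :
  forall k, ~ shulga_stop alpha b c k /\ shulga_step alpha b c k.

Let track n : on_track alpha b c n.
Proof. exact: run_on_track. Qed.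

Let facts n : round_facts alpha b c n.
Proof.
by have [] := shulga_step_facts _ _ _ _ _ (track n) (proj1 (run n)) (proj2 (run n)).
Qed.

Lemma run_b_gt0 i : (0 < i)%N -> (0 < b i)%N.
Proof. by move=> i0; have [bpos _ _ _] := track i; apply: bpos; rewrite i0 /=. Qed.

Lemma run_c_gt0 i : (0 < i)%N -> (0 < c i)%N.
Proof. by move=> i0; have [_ cpos _ _] := track i; apply: cpos; rewrite i0 /=. Qed.

Let bpos n : positive_upto b n := positive_all b n run_b_gt0.
Let cpos n : positive_upto c n := positive_all c n run_c_gt0.

Lemma run_b_le_c i : (0 < i)%N -> (b i <= c i)%N.
Proof.
move=> i0; apply: (drift_dominates b c i (bpos i) (cpos i)); last by rewrite i0 /=.
by move=> k _; have [] := facts k.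
Qed.

Lemma run_ratio H : exists N, forall n, (N <= n)%N ->
  (H * den b n <= den c n + den' c n)%N.
Proof.
apply: (ratio_unbounded _ _ run_b_gt0 run_c_gt0 _ _ R) => n; by have [] := facts n.
Qed.

(** Follows from [round_lower]: consecutive denominators of [b] grow at least
    by the factor [ratio]. *)
Lemma run_b_cvg : b n @[n --> \oo] --> \oo.
Proof.
apply/cvgnyPge => A; have [N NP] := run_ratio A.+1.
exists N.+1 => // -[//|n] /= /NP ratio_n.
have low := round_lower _ _ _ _ (facts n).
have r0 := den_gt0 (bpos n).
have rq : (den b n <= den c n)%N.
  by have [] := den'_le b c n (fun i i0 => run_b_le_c i (proj1 (andP i0))).
have r' := den'_le_den (bpos n).
rewrite denS in low.
have : (A.+1 * den b n <= b n.+1 * den b n + den' b n)%N.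
  rewrite -(leq_pmul2l r0); apply: leq_trans low.
  by rewrite leq_mul.
move=> le; have : (A.+1 * den b n <= (b n.+1).+1 * den b n)%N by rewrite mulSn; lia.
by rewrite leq_pmul2r.
Qed.

Lemma run_c_cvg : c n @[n --> \oo] --> \oo.
Proof.
apply/cvgnyPge => A; have /cvgnyPge/(_ A)[N _ NP] := run_b_cvg.
exists N.+1 => // -[//|n] /= nN.
by apply: leq_trans (run_b_le_c n.+1 isT); apply: NP; exact: leqW.
Qed.

(** The error of order [n], multiplied by [Q * den b n * den c n], is a nonzero
    integer; this bounds [ratio] by [Q]. *)
Lemma run_irrational : ~ rational alpha.
Proof.
move=> /rational_den[Q [P [Q0 PE]]].
have [N /(_ N (leqnn N))] := run_ratio Q.+1.
have err := round_error _ _ _ _ (facts N).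
have [nstop _] := run N.
set D := alpha - _ - _ in err.
have D0 : D != 0.
  apply/eqP => /eqP; rewrite /D subr_eq0 => /eqP E; apply: nstop.
  by rewrite /shulga_stop -E subrKC.
have r0 := den_gt0 (bpos N); have q0 := den_gt0 (cpos N).
have DE : D * (Q * den b N * den c N)%:R =
  (P * (den b N * den c N)%:Z - (numer b N * Q * den c N)%:Z
    - (numer c N * Q * den b N)%:Z)%:~R.
  rewrite !intrB intrM -!pmulrn !natrM -PE.
  by rewrite -!convergent_den // /D; ring.
have D1 : 1 <= `|D| * (Q * den b N * den c N)%:R.
  rewrite -[X in _ * X]ger0_norm ?ler0n // -normrM DE -intr_norm.
  rewrite ler1z -gtz0_ge1 normr_gt0 -(intr_eq0 R) -DE mulf_neq0 //.
  by rewrite pnatr_eq0 -lt0n !muln_gt0 Q0 r0 q0.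
have Dn : 0 < `|D| by rewrite normr_gt0.
have := le_trans err D1; rewrite ler_pM2l // ler_nat mulnC leq_pmul2r //.
by rewrite mulSn; lia.
Qed.

Lemma run_error_cvg :
  (convergent R b n + convergent R c n) @[n --> \oo] --> alpha.
Proof.
apply/cvgrPdist_le => /= e e0; near=> n.
have err := round_error _ _ _ _ (facts n).
rewrite opprD addrA.
have q0 : (0 : R) < (den c n)%:R by rewrite ltr0n den_gt0.
have nq : (n%:R : R) <= (den c n)%:R by rewrite ler_nat den_ge.
have ne : e^-1 <= n%:R by near: n; exact: nbhs_infty_ger.
have qq : (den c n <= den c n * (den c n + den' c n))%N.
  by rewrite leq_pmulr // addn_gt0 den_gt0.
have D0 : (0 : R) < (den c n * (den c n + den' c n))%:R.
  by rewrite ltr0n (leq_trans _ qq) // den_gt0.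
move: err; rewrite -ler_pdivlMr // div1r => /le_trans; apply.
rewrite -[e]invrK lef_pV2 ?posrE ?invr_gt0 //.
by apply: le_trans ne _; apply: le_trans nq _; rewrite ler_nat.
Unshelve. all: by end_near. Qed.

End InfiniteRun.

Lemma G_infinite (R : realType) (x : R) (a : nat -> nat) :
  (forall i, (0 < i)%N -> (0 < a i)%N) ->
  convergent R a n @[n --> \oo] --> x -> a n @[n --> \oo] --> \oo -> G x.
Proof.
move=> apos cvx cva; right; exists a; split=> // n n0; split=> //; right.
exists 0, a; split=> //; split=> //.
by rewrite (_ : (fun n => _) = convergent R a) //; apply/funext => k; rewrite add0r.
Qed.

Theorem corollary5 (R : realType) (alpha : R) (halpha : 0 <= alpha <= 1) :
  (exists beta gamma : R, shulga_decomposition alpha beta gamma) /\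
  (forall beta gamma : R, shulga_decomposition alpha beta gamma ->
     [/\ alpha = beta + gamma,
         G beta /\ G gamma
       & rational alpha -> rational beta /\ rational gamma]).
Proof.
split; first exact: shulga_decomposition_exists.
move=> beta gamma [b [c [[n [_ stop -> ->]]|[run cvb cvc]]]].
  by split=> //; split; try left; exact: rational_cfrac.
split.
- apply: (norm_cvg_unique (run_error_cvg alpha b c halpha run)).
  exact: cvgD.
- split; [apply: (G_infinite _ _ b)|apply: (G_infinite _ _ c)] => //.
  + exact: run_b_gt0 halpha run.
  + exact: run_b_cvg halpha run.
  + exact: run_c_gt0 halpha run.
  + exact: run_c_cvg halpha run.
- by move=> ratA; case: (run_irrational alpha b c halpha run ratA).
Qed.
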